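(* Let $A_\Gamma$ be an Artin group, let $\Omega,\Delta$ be induced subgraphs of $\Gamma$ and $g,h\in A_\Gamma$, and suppose that the parabolic subgroups $gA_\Omega g^{-1}$ and $hA_\Delta h^{-1}$ satisfy $gA_\Omega g^{-1}\subset hA_\Delta h^{-1}$. Then $|V(\Omega)|\le |V(\Delta)|$ and, if $|V(\Omega)|=|V(\Delta)|$, then $gA_\Omega g^{-1}=hA_\Delta h^{-1}$.
   Context: Let $\Gamma$ be a finite non-empty simplicial graph with vertex set $V(\Gamma)$, edge set $E(\Gamma)$ and an edge-labeling $m\colon E(\Gamma)\to\{2,3,4,\ldots\}$. The Artin group $A_\Gamma$ is the group with generating set $V(\Gamma)$ and relations $vwv\cdots = wvw\cdots$ (both sides alternating words with $m(\{v,w\})$ letters) for each $\{v,w\}\in E(\Gamma)$. For an induced subgraph $\Omega$ of $\Gamma$, $A_\Omega$ denotes the subgroup of $A_\Gamma$ generated by $V(\Omega)$ (canonically isomorphic to the Artin group of the labeled graph $\Omega$ by van der Lek); conjugates of such subgroups are called parabolic subgroups. *)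

(* Defs.v *)
From HB Require Import structures.
From mathcomp Require Import all_boot.
From mathcomp Require Import boolp classical_sets.

Set Implicit Arguments.
Unset Strict Implicit.
Unset Printing Implicit Defensive.

Local Open Scope classical_set_scope.
Local Open Scope quotient_scope.
Local Open Scope group_scope.

(* The edges of a simplicial graph (no loops, no multiple edges) are
   2-element sets of vertices; [label] is only meaningful on edges. *)
Record labeled_graph := LabeledGraph {
  vertex :> finType;
  edges : {set {set vertex}};
  label : {set vertex} -> nat;
  vertex_gt0 : 0 < #|vertex|;
  card_edge : forall e, e \in edges -> #|e| = 2;
  label_gt1 : forall e, e \in edges -> 1 < label e
}.

Section Presentation.

Variable T : choiceType.

(* The letter [(v, false)] stands for v and [(v, true)] for v^-1. *)
Definition word := seq (T * bool).

Definition inv_letter (x : T * bool) : T * bool := (x.1, ~~ x.2).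
Definition inv_word (u : word) : word := rev (map inv_letter u).

Variable rels : word -> word -> Prop.

Inductive pres_eq : word -> word -> Prop :=
| pres_refl u : pres_eq u u
| pres_sym u v : pres_eq u v -> pres_eq v u
| pres_trans v u w : pres_eq u v -> pres_eq v w -> pres_eq u w
| pres_cat u u' v v' :
    pres_eq u u' -> pres_eq v v' -> pres_eq (u ++ v) (u' ++ v')
| pres_cancel x : pres_eq [:: x; inv_letter x] [::]
| pres_rel u v : rels u v -> pres_eq u v.

Definition pres_eqb : rel word := fun u v => `[< pres_eq u v >].

Lemma pres_eqb_refl : reflexive pres_eqb.
Proof. by move=> u; apply/asboolP/pres_refl. Qed.

Lemma pres_eqb_sym : symmetric pres_eqb.
Proof.
by move=> u v; apply/asboolP/asboolP => uv; apply: pres_sym.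
Qed.

Lemma pres_eqb_trans : transitive pres_eqb.
Proof.
move=> v u w /asboolP uv /asboolP vw.
by apply/asboolP; apply: pres_trans uv vw.
Qed.

Canonical pres_equiv :=
  EquivRel pres_eqb pres_eqb_refl pres_eqb_sym pres_eqb_trans.

Definition presented := {eq_quot pres_equiv}.

HB.instance Definition _ := Choice.on presented.
HB.instance Definition _ := EqQuotient.on presented.

Lemma pres_piP u v : \pi_presented u = \pi_presented v <-> pres_eq u v.
Proof.
by split=> [/eqmodP/asboolP // | uv]; apply/eqmodP/asboolP.
Qed.

Lemma inv_letterK : involutive inv_letter.
Proof. by case=> x b; rewrite /inv_letter /= negbK. Qed.

Lemma inv_wordK : involutive inv_word.
Proof.
by move=> u; rewrite /inv_word map_rev revK -map_comp map_id_in // => x _ /=;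
  rewrite inv_letterK.
Qed.

Lemma inv_word_cat u v : inv_word (u ++ v) = inv_word v ++ inv_word u.
Proof. by rewrite /inv_word map_cat rev_cat. Qed.

Lemma pres_mulgV u : pres_eq (u ++ inv_word u) [::].
Proof.
elim: u => [|x u IH]; first exact: pres_refl.
rewrite -(cat1s x) inv_word_cat -catA (catA u).
apply: pres_trans (pres_cancel x).
rewrite -[[:: x; _]]/([:: x] ++ ([::] ++ inv_word [:: x])).
apply: pres_cat; first exact: pres_refl.
by apply: pres_cat IH _; apply: pres_refl.
Qed.

Lemma pres_mulVg u : pres_eq (inv_word u ++ u) [::].
Proof. by have := pres_mulgV (inv_word u); rewrite inv_wordK. Qed.

Lemma pres_inv u v : pres_eq u v -> pres_eq (inv_word u) (inv_word v).
Proof.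
move=> uv.
apply: (@pres_trans (inv_word u ++ (v ++ inv_word v))).
  rewrite -[X in pres_eq X _]cats0.
  by apply: pres_cat; [apply: pres_refl | apply/pres_sym/pres_mulgV].
rewrite catA -[X in pres_eq _ X]cat0s.
apply: pres_cat; last exact: pres_refl.
apply: pres_trans (pres_mulVg u).
by apply: pres_cat; [apply: pres_refl | apply: pres_sym].
Qed.

Definition pres_one : presented := \pi_presented [::].
Definition pres_mul (x y : presented) : presented :=
  \pi_presented (repr x ++ repr y).
Definition pres_invg (x : presented) : presented :=
  \pi_presented (inv_word (repr x)).

Lemma pres_repr u : pres_eq (repr (\pi_presented u)) u.
Proof. by apply/pres_piP; rewrite reprK. Qed.

Lemma pres_mul_pi u v :
  pres_mul (\pi_presented u) (\pi_presented v) = \pi_presented (u ++ v).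
Proof. by apply/pres_piP; apply: pres_cat; apply: pres_repr. Qed.

Lemma pres_inv_pi u :
  pres_invg (\pi_presented u) = \pi_presented (inv_word u).
Proof. by apply/pres_piP; apply: pres_inv; apply: pres_repr. Qed.

Lemma pres_mulA : associative pres_mul.
Proof.
move=> x y z; rewrite -[x]reprK -[y]reprK -[z]reprK.
rewrite (pres_mul_pi (repr x) (repr y)) (pres_mul_pi (repr y)).
by rewrite !pres_mul_pi catA.
Qed.

Lemma pres_mul1 : left_id pres_one pres_mul.
Proof. by move=> x; rewrite -[x]reprK /pres_one pres_mul_pi cat0s. Qed.

Lemma pres_mulr1 : right_id pres_one pres_mul.
Proof. by move=> x; rewrite -[x]reprK /pres_one pres_mul_pi cats0. Qed.

Lemma pres_mulV : left_inverse pres_one pres_invg pres_mul.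
Proof.
move=> x; rewrite -[x]reprK pres_inv_pi pres_mul_pi.
by apply/pres_piP; apply: pres_mulVg.
Qed.

Lemma pres_mulrV : right_inverse pres_one pres_invg pres_mul.
Proof.
move=> x; rewrite -[x]reprK pres_inv_pi pres_mul_pi.
by apply/pres_piP; apply: pres_mulgV.
Qed.

HB.instance Definition _ := isGroup.Build presented
  pres_mulA pres_mul1 pres_mulr1 pres_mulV pres_mulrV.

Definition pres_gen (x : T) : presented := \pi_presented [:: (x, false)].

End Presentation.

(* The word v w v ... with n letters. *)
Definition alternating (T : choiceType) (v w : T) (n : nat) : word T :=
  [seq (if odd i then w else v, false) | i <- iota 0 n].

Definition artin_rels (Gamma : labeled_graph) (r s : word Gamma) : Prop :=
  exists v w : Gamma, [set v; w]%SET \in edges Gamma /\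
    let m := label [set v; w]%SET in
    r = alternating v w m /\ s = alternating w v m.

Definition artin (Gamma : labeled_graph) : groupType :=
  presented (@artin_rels Gamma).

Definition artin_gen (Gamma : labeled_graph) (v : Gamma) : artin Gamma :=
  pres_gen (@artin_rels Gamma) v.

Definition subgroup (G : groupType) (H : set G) : Prop :=
  [/\ H 1, forall x y, H x -> H y -> H (x * y) & forall x, H x -> H x^-1].

Definition generated (G : groupType) (S : set G) : set G :=
  smallest (@subgroup G) S.

Definition conjugate (G : groupType) (g : G) (H : set G) : set G :=
  [set g * x * g^-1 | x in H].

(* An induced subgraph of Gamma is determined by its vertex set X, and
   A_X is the subgroup generated by X. *)
Definition std_parabolic (Gamma : labeled_graph) (X : {set Gamma}) :
    set (artin Gamma) :=
  generated [set artin_gen v | v in [set` X]].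

(* Main.v *)
Require Import Defs.
From mathcomp Require Import all_boot all_order all_algebra.
From mathcomp Require Import Rstruct.
From mathcomp Require Import boolp classical_sets reals trigo.
From mathcomp Require Import ring lra.

(** Conjugating by the inverse of h reduces the theorem to an inclusion of
    k A_Omega k^-1 in A_Delta.  The proof produces e in A_Delta and an injective
    map f from Omega to Delta such that k y k^-1 = e f(y) e^-1 for all y in
    Omega ([conj_gen_into_parabolic]).  The inequality of cardinalities is then
    clear, and if Omega and Delta have the same size then f is onto Delta, so
    that k A_Omega k^-1 contains e A_Delta e^-1 = A_Delta.

    The elements e and f(y) come from a cocycle with values in A_Delta.  Let W be
    the Coxeter group of Gamma.  The group A acts through W on the right cosets
    of W_Delta in W, and each coset has one representative of minimal length.
    When a generator r is applied to a minimal representative, either the product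
    is again minimal, or the coset is fixed and r is conjugated by the
    representative to some generator x in Delta.  A word is read letter by letter
    and the letter x is output each time the second case occurs.  Once this
    output is known to depend, as an element of A, only on the element of A that
    the word represents ([run_pres_eq]), the argument is short.  Words over
    Delta fix the trivial coset and are output unchanged.  Let e be the output
    of k, read from the trivial coset.  For y in Omega the element k y k^-1 lies
    in A_Delta, so it fixes the trivial coset; hence y fixes the coset reached by
    k, and it outputs there a letter f(y) in Delta.  The output of k y k^-1 is
    on the one hand k y k^-1 itself, on the other hand e f(y) e^-1.

    Minimal representatives are handled through the reflection representation
    of W on the real vector space with basis the simple roots alpha_s.  A coset
    is encoded by the inverse v of its minimal representative, which is the one
    sending alpha_x to a nonnegative vector for each x in Delta; the generator r
    fixes the coset exactly when v alpha_x = alpha_r for some x in Delta.  This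
    rests on the theorem that each root is nonnegative or nonpositive
    ([root_sign]).  The invariance of the output under the braid relation of s
    and t ([run_braid]) depends on how many of the roots v alpha_x lie in the
    plane spanned by alpha_s and alpha_t.  If two do, they must be alpha_s and
    alpha_t themselves, and the two sides of the braid relation output the two
    sides of a braid relation with the same label in Delta.  If one does, both
    sides output this one letter, once; if none does, the output is empty. *)

Set Implicit Arguments.
Unset Strict Implicit.
Unset Printing Implicit Defensive.

Import Order.TTheory GRing.Theory Num.Theory.

(** * Chebyshev polynomials and dihedral angles *)

Section Chebyshev.
Local Open Scope ring_scope.
Variable R : realType.
Implicit Types (c : R) (k m : nat).

(** The Chebyshev polynomials of the second kind, shifted by one in the index and
    evaluated at c / 2.  They are the coordinates of the roots of a dihedral group
    whose two simple roots have Cartan entry - c. *)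
Fixpoint cheb c k : R :=
  if k is k'.+1 then (if k' is j.+1 then c * cheb c k' - cheb c j else 1)
  else 0.

Lemma chebSS c k : cheb c k.+2 = c * cheb c k.+1 - cheb c k.
Proof. by []. Qed.

Lemma cheb0 c : cheb c 0 = 0. Proof. by []. Qed.

Lemma cheb1 c : cheb c 1 = 1. Proof. by []. Qed.

Arguments cheb : simpl never.

(** The value c = 2 is that of a pair of generators without relation: the
    coordinates never become negative. *)
Lemma cheb2 k : cheb 2 k = k%:R.
Proof.
suff: cheb 2 k = k%:R /\ cheb 2 k.+1 = k.+1%:R by case.
elim: k => [//|k [IH1 IH2]]; split=> //.
rewrite chebSS IH1 IH2 -!natr1; ring.
Qed.

Lemma sin_cheb (x : R) k : sin x * cheb (2 * cos x) k = sin (k%:R * x).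
Proof.
suff: sin x * cheb (2 * cos x) k = sin (k%:R * x) /\
      sin x * cheb (2 * cos x) k.+1 = sin (k.+1%:R * x) by case.
elim: k => [|k [IH1 IH2]]; first by rewrite mulr0 mul0r sin0 mulr1 mul1r.
split=> //; rewrite chebSS mulrBr IH1 mulrCA IH2.
have -> : k.+2%:R * x = k.+1%:R * x + x by rewrite -(natr1 k.+1) mulrDl mul1r.
have -> : k%:R * x = k.+1%:R * x - x by rewrite -(natr1 k) mulrDl mul1r addrK.
rewrite sinB sinD; ring.
Qed.

Lemma angle_itv m : (1 < m)%N -> 0 < (pi / m%:R : R) < pi.
Proof.
move=> m1; have m0 : 0 < m%:R :> R by rewrite ltr0n ltnW.
rewrite divr_gt0 ?pi_gt0 //= ltr_pdivrMr // ltr_pMr ?pi_gt0 //.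
by rewrite ltr1n.
Qed.

Lemma cheb_ge0 m k : (1 < m)%N -> (k <= m)%N -> 0 <= cheb (2 * cos (pi / m%:R : R)) k.
Proof.
move=> m1 km; have m0 : 0 < m%:R :> R by rewrite ltr0n ltnW.
have s0 : 0 < sin (pi / m%:R : R) by apply/sin_gt0_pi/angle_itv.
rewrite -(pmulr_rge0 _ s0) sin_cheb sin_ge0_pi // mulrCA.
rewrite mulr_ge0 ?pi_ge0 ?divr_ge0 //=.
by rewrite ler_piMr ?pi_ge0 // ler_pdivrMr // mul1r ler_nat.
Qed.

Lemma cheb_order m : (1 < m)%N -> cheb (2 * cos (pi / m%:R : R)) m = 0.
Proof.
move=> m1; have m0 : m%:R != 0 :> R by rewrite pnatr_eq0 -lt0n ltnW.
have s0 : 0 < sin (pi / m%:R : R) by apply/sin_gt0_pi/angle_itv.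
apply: (mulfI (lt0r_neq0 s0)).
by rewrite mulr0 sin_cheb mulrCA divff // mulr1 sinpi.
Qed.

Lemma cos_angle_inj m n : (1 < m)%N -> (1 < n)%N ->
  cos (pi / m%:R : R) = cos (pi / n%:R) -> m = n.
Proof.
move=> m1 n1 /cos_inj e.
have := angle_itv m1; have := angle_itv n1 => /andP[n0 np] /andP[m0 mp].
have pi0 : (pi : R) != 0 by rewrite gt_eqF // pi_gt0.
have /(mulfI pi0)/invr_inj/eqP : pi / m%:R = pi / n%:R :> R.
  by apply: e; rewrite in_itv /= ?(ltW m0) ?(ltW n0) ?(ltW mp) ?(ltW np).
by rewrite eqr_nat => /eqP.
Qed.

Lemma cos_angle_neq1 m : (1 < m)%N -> cos (pi / m%:R : R) != 1.
Proof.
move=> m1; apply/eqP; rewrite -[RHS]cos0 => /cos_inj e.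
have := angle_itv m1 => /andP[m0 mp].
suff e0 : pi / m%:R = 0 :> R by rewrite e0 ltxx in m0.
by apply: e; rewrite in_itv /= ?lexx ?(ltW m0) ?(ltW mp) ?pi_ge0.
Qed.

End Chebyshev.
Arguments cheb : simpl never.

(** * The reflection representation *)

Section Reflections.
Local Open Scope ring_scope.
Variables (R : realType) (Gamma : labeled_graph).
Local Notation V := {ffun Gamma -> R^o}.
Implicit Types (p q : V) (r s t a b x y : Gamma) (u w d : seq Gamma).

(** Twice the cosine form of the Coxeter group; pairs that are not edges have
    label infinity, hence the limit value - 2. *)
Definition cartan s t : R :=
  if s == t then 2 else
  if [set s; t]%SET \in edges Gamma
  then - (2 * cos (pi / (label [set s; t]%SET)%:R)) else - 2.

Definition simple_root s : V := [ffun a => (a == s)%:R : R].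
Local Notation alpha := simple_root.

Definition form p q : R := \sum_a \sum_b (p a : R) * q b * cartan a b.

Definition refl s p : V := p - form p (alpha s) *: alpha s.

Definition act w p : V := foldr refl p w.

Lemma act_nil p : act [::] p = p. Proof. by []. Qed.

Lemma act_cons s w p : act (s :: w) p = refl s (act w p). Proof. by []. Qed.

Arguments act : simpl never.

Definition nonneg p := forall a, 0 <= p a.

Lemma cartanC s t : cartan s t = cartan t s.
Proof. by rewrite /cartan eq_sym finset.setUC. Qed.

Lemma formC p q : form p q = form q p.
Proof.
rewrite /form exchange_big; apply: eq_bigr => a _; apply: eq_bigr => b _.
by rewrite cartanC (mulrC (p _)). 
Qed.

Lemma formDl p p' q : form (p + p') q = form p q + form p' q.
Proof.
rewrite /form -big_split; apply: eq_bigr => a _ /=.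
rewrite -big_split; apply: eq_bigr => b _ /=; rewrite !ffunE; ring.
Qed.

Lemma formZl c p q : form (c *: p) q = c * form p q.
Proof.
rewrite /form mulr_sumr; apply: eq_bigr => a _ /=.
rewrite mulr_sumr; apply: eq_bigr => b _ /=; rewrite !ffunE /=.
by rewrite -!mulrA.
Qed.

Lemma formBl p p' q : form (p - p') q = form p q - form p' q.
Proof. by rewrite formDl -scaleN1r formZl mulN1r. Qed.

Lemma formZr c p q : form q (c *: p) = c * form q p.
Proof. by rewrite ![form q _]formC formZl. Qed.

Lemma formBr p p' q : form q (p - p') = form q p - form q p'.
Proof. by rewrite ![form q _]formC formBl. Qed.

Lemma form_root s t : form (alpha s) (alpha t) = cartan s t.
Proof.
rewrite /form (bigD1 s) //= (bigD1 t) //= !ffunE !eqxx !mul1r.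
rewrite big1 => [|b /negPf bt]; last by rewrite ffunE bt mulr0 mul0r.
rewrite big1 ?addr0 // => a /negPf as_.
by rewrite big1 // => b _; rewrite ffunE as_ !mul0r.
Qed.

Lemma cartan_diag s : cartan s s = 2.
Proof. by rewrite /cartan eqxx. Qed.

Lemma alphaE s : alpha s s = 1. Proof. by rewrite ffunE eqxx. Qed.

Lemma alpha_neq s t : s != t -> alpha s t = 0.
Proof. by move=> /negPf st; rewrite ffunE eq_sym st. Qed.

Lemma refl_neq s p a : a != s -> refl s p a = p a.
Proof. by move=> /negPf e; rewrite !ffunE e /= scaler0 subr0. Qed.

Lemma refl_root s : refl s (alpha s) = - alpha s.
Proof. by rewrite /refl form_root cartan_diag scaler_nat mulr2n opprD addNKr. Qed.

Lemma reflD s p q : refl s (p + q) = refl s p + refl s q.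
Proof. by rewrite /refl formDl scalerDl opprD addrACA. Qed.

Lemma reflZ s c p : refl s (c *: p) = c *: refl s p.
Proof. by rewrite /refl formZl scalerBr scalerA. Qed.

Lemma reflK s : involutive (refl s).
Proof.
move=> p; rewrite {1}/refl /refl formBl formZl form_root cartan_diag.
apply/ffunP => a; rewrite !ffunE; rewrite /GRing.scale /=; ring.
Qed.

Lemma form_refl s p q : form (refl s p) (refl s q) = form p q.
Proof.
rewrite /refl !(formBl, formBr, formZl, formZr) form_root cartan_diag.
by rewrite [form (alpha s) q]formC; ring.
Qed.

Lemma act_cat u w p : act (u ++ w) p = act u (act w p).
Proof. exact: foldr_cat. Qed.

Lemma act_rcons u s p : act (rcons u s) p = act u (refl s p).
Proof. by rewrite -cats1 act_cat. Qed.

Lemma actD w p q : act w (p + q) = act w p + act w q.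
Proof. by elim: w => // s w IH; rewrite !act_cons IH reflD. Qed.

Lemma actZ w c p : act w (c *: p) = c *: act w p.
Proof. by elim: w => // s w IH; rewrite !act_cons IH reflZ. Qed.

Lemma actN w p : act w (- p) = - act w p.
Proof. by rewrite -scaleN1r actZ scaleN1r. Qed.

Lemma act_revK w : cancel (act w) (act (rev w)).
Proof.
by elim: w => [//|s w IH] p; rewrite rev_cons act_rcons act_cons reflK IH.
Qed.

Lemma act_revKV w : cancel (act (rev w)) (act w).
Proof. by move=> p; rewrite -{1}[w]revK act_revK. Qed.

Lemma act_inj w : injective (act w).
Proof. exact: can_inj (act_revK w). Qed.

Lemma act0 w : act w 0 = 0.
Proof. by have := actZ w 0 0; rewrite !scale0r. Qed.

Lemma form_act w p q : form (act w p) (act w q) = form p q.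
Proof. by elim: w => // s w IH; rewrite !act_cons form_refl. Qed.

Lemma alpha_neq0 s : alpha s != 0.
Proof.
by apply/eqP => /ffunP/(_ s)/eqP; rewrite alphaE ffunE oner_eq0.
Qed.

Lemma alpha_inj : injective alpha.
Proof.
move=> s t /ffunP/(_ s); rewrite alphaE ffunE.
by case: eqP => // _ /eqP; rewrite oner_eq0.
Qed.

(** The reflection in w alpha_s is the conjugate by w of the reflection in
    alpha_s, because the form is invariant. *)
Lemma refl_act w s r p : act w (alpha s) = alpha r ->
  refl r (act w p) = act w (refl s p).
Proof.
move=> e; by rewrite /refl -e form_act actD actN actZ.
Qed.

Lemma nonnegD p q : nonneg p -> nonneg q -> nonneg (p + q).
Proof. by move=> hp hq a; rewrite ffunE addr_ge0. Qed.

Lemma nonnegZ c p : 0 <= c -> nonneg p -> nonneg (c *: p).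
Proof. by move=> hc hp a; rewrite ffunE mulr_ge0. Qed.

Lemma nonneg_alpha s : nonneg (alpha s).
Proof. by move=> a; rewrite ffunE. Qed.

Lemma nonneg_antisym p : nonneg p -> nonneg (- p) -> p = 0.
Proof.
move=> h h'; apply/ffunP => a; apply/eqP; rewrite ffunE.
by have := h' a; rewrite ffunE oppr_ge0 eq_le h => ->.
Qed.

Lemma act_root_neq0 w s : act w (alpha s) != 0.
Proof. by rewrite -(act0 w) (inj_eq (act_inj (w:=w))) alpha_neq0. Qed.

Lemma root_not_both w s :
  nonneg (act w (alpha s)) -> nonneg (- act w (alpha s)) -> False.
Proof.
by move=> h h'; have /eqP := act_root_neq0 w s; apply; apply: nonneg_antisym.
Qed.

(** All roots have the same norm, which fixes the scalar. *)
Lemma root_multiple w s r c : 0 <= c ->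
  act w (alpha s) = c *: alpha r -> act w (alpha s) = alpha r.
Proof.
move=> c0 e; have := form_act w (alpha s) (alpha s).
rewrite e formZl formZr !form_root !cartan_diag => h.
have c1 : c ^+ 2 = 1 by lra.
move/eqP: c1; rewrite sqrf_eq1 => /orP[/eqP->|/eqP e1]; first by rewrite scale1r.
by move: c0; rewrite e1 oppr_ge0 ler10.
Qed.

(** The reflection in alpha_r only changes the coordinate at r, so the only
    nonnegative root that it makes nonpositive is alpha_r. *)
Lemma simple_root_flip w s r : nonneg (act w (alpha s)) ->
  nonneg (- refl r (act w (alpha s))) -> act w (alpha s) = alpha r.
Proof.
set p := act w (alpha s) => hp hn.
apply: (@root_multiple w s r (p r)) => //; apply/ffunP => a.
rewrite -/p !ffunE /GRing.scale /=; have [->|ar] := eqVneq a r; first by rewrite mulr1.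
rewrite mulr0; apply/eqP; rewrite eq_le hp andbT.
by have := hn a; rewrite ffunE refl_neq // oppr_ge0.
Qed.

(** The alternating word a b a ..., which [act] applies from its last letter. *)
Fixpoint zig a b k : seq Gamma := if k is k'.+1 then a :: zig b a k' else [::].

Lemma zigS a b k : zig a b k.+1 = zig a b k ++ [:: if odd k then b else a].
Proof.
by elim: k a b => [//|k IH] a b; rewrite -[LHS]/(a :: zig b a k.+1) IH /= if_neg.
Qed.

Lemma size_zig a b k : size (zig a b k) = k.
Proof. by elim: k a b => //= k IH a b; rewrite IH. Qed.

Lemma rev_zig a b k :
  rev (zig a b k) = if odd k then zig a b k else zig b a k.
Proof.
elim: k a b => [//|k IH] a b; rewrite zigS rev_cat; rewrite IH /=.
by case: (odd k) (zigS a b k).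
Qed.

Local Notation U a b := (cheb (- cartan a b)).

(** The simple root on the right is the one that the rightmost letter of the word
    does not negate. *)
Lemma zig_root a b k : a != b ->
  act (zig a b k) (alpha (if odd k then b else a)) =
  U a b k.+1 *: alpha a + U a b k *: alpha b.
Proof.
elim: k a b => [|k IH] a b ab; first by rewrite act_nil cheb0 cheb1 scale1r scale0r addr0.
have -> : (if odd k.+1 then b else a) = if odd k then a else b.
  by rewrite /=; case: odd.
rewrite chebSS act_cons IH 1?eq_sym // (cartanC b a) reflD !reflZ refl_root.
rewrite /refl form_root (cartanC b a).
by apply/ffunP => c; rewrite !ffunE /GRing.scale /=; ring.
Qed.

(** Acting by the reversed word makes a the first reflection applied, so that the
    j-th one subtracts a multiple of alpha_a or alpha_b whose scalar obeys the
    Chebyshev recurrence. *)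
Lemma zig_rev_form a b k p : a != b ->
  act (rev (zig a b k)) p = p - \sum_(j < k)
    (U a b j.+1 * form p (alpha a) + U a b j * form p (alpha b))
      *: alpha (if odd j then b else a).
Proof.
elim: k a b p => [|k IH] a b p ab; first by rewrite big_ord0 subr0.
rewrite rev_cons act_rcons IH 1?eq_sym // big_ord_recl /= cheb0 cheb1 mul1r mul0r addr0.
rewrite opprD addrA; congr (_ - _); apply: eq_bigr => j _.
rewrite if_neg add0n chebSS; congr (_ *: _).
rewrite /refl !formBl !formZl !form_root cartan_diag (cartanC b a) /=.
ring.
Qed.

Section Edge.
Variables (s t : Gamma) (stE : [set s; t]%SET \in edges Gamma).
Local Notation m := (label [set s; t]%SET).

Lemma edge_neq : s != t.
Proof. by have := card_edge stE; rewrite cards2; case: (s != t). Qed.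

Lemma cartan_edge : cartan s t = - (2 * cos (pi / m%:R)).
Proof. by rewrite /cartan (negPf edge_neq) stE. Qed.

Lemma cheb_edge_ge0 k : (k <= m)%N -> 0 <= U s t k.
Proof. by rewrite cartan_edge opprK; apply/cheb_ge0/label_gt1. Qed.

Lemma cheb_edge_order : U s t m = 0.
Proof. by rewrite cartan_edge opprK cheb_order // label_gt1. Qed.

(** After reindexing, the sums given by [zig_rev_form] for the two words differ by
    one term of index 0 and one of index m, and both vanish since the Chebyshev
    polynomials of these indices do. *)
Lemma braid_rev p : act (rev (zig s t m)) p = act (rev (zig t s m)) p.
Proof.
have st := edge_neq; have ts : t != s by rewrite eq_sym.
rewrite (zig_rev_form _ _ st) (zig_rev_form _ _ ts) (cartanC t s).
congr (_ - _).
apply/eqP; rewrite -subr_eq0 -sumrB; apply/eqP.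
pose S (i : nat) : V := (U s t i * form p (alpha s)) *: alpha (if odd i then s else t)
  - (U s t i * form p (alpha t)) *: alpha (if odd i then t else s).
transitivity (\sum_(j < m) (S j.+1 - S j)).
  apply: eq_bigr => j _; rewrite /S /= !if_neg.
  by apply/ffunP => c; rewrite !ffunE /GRing.scale /=; ring.
rewrite -(big_mkord xpredT (fun j => S j.+1 - S j)) telescope_sumr //.
by rewrite /S cheb_edge_order /= !mul0r !scale0r !subr0.
Qed.

Lemma braid p : act (zig s t m) p = act (zig t s m) p.
Proof.
have := braid_rev p; rewrite !rev_zig; case: ifP => // _ h; exact: esym.
Qed.

End Edge.

End Reflections.
Arguments act : simpl never.

(** * Roots are nonnegative or nonpositive *)

Section Roots.
Local Open Scope ring_scope.
Variables (R : realType) (Gamma : labeled_graph).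
Local Notation V := {ffun Gamma -> R^o}.
Local Notation alpha := (simple_root R).
Local Notation act := (@act R Gamma).
Local Notation U a b := (cheb (- cartan R a b)).
Local Notation "[ 'edge' s ; t ]" := ([set s; t]%SET \in edges Gamma).
Local Notation m_ s t := (label [set s; t]%SET).
Implicit Types (p q : V) (r s t a b x y : Gamma) (u w d : seq Gamma).

Lemma cheb_cartan_ge0 s t k : s != t ->
  ([edge s; t] -> (k <= m_ s t)%N) -> 0 <= U s t k.
Proof.
move=> /negPf st; have [e h|e _] := boolP [edge s; t].
  by apply: cheb_edge_ge0 => //; apply: h.
by rewrite /cartan st (negPf e) opprK cheb2.
Qed.

Definition cone s t p :=
  exists c c' : R, [/\ 0 <= c, 0 <= c' & p = c *: alpha s + c' *: alpha t].

Lemma coneC s t p : cone s t p -> cone t s p.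
Proof. by move=> [c [c' [h h' e]]]; exists c', c; split; rewrite // addrC. Qed.

Lemma cone_nonneg s t p : cone s t p -> nonneg p.
Proof.
move=> [c [c' [h h' ->]]]; apply: nonnegD; apply: nonnegZ => //;
  exact: nonneg_alpha.
Qed.

Lemma zig_cone a b k : a != b -> ([edge a; b] -> (k < m_ a b)%N) ->
  cone a b (act (zig a b k) (alpha (if odd k then b else a))).
Proof.
move=> ab h; rewrite zig_root //; exists (U a b k.+1), (U a b k).
by split=> //; apply: cheb_cartan_ge0 => // /h => // /ltnW.
Qed.

(** Reading a word over two letters from right to left, a new letter either
    extends the alternating word, or cancels with its first letter; at length m
    the braid relation first exchanges the two alternating words, so that the
    letter cancels. *)
Lemma zig_normal a0 b0 d : a0 != b0 -> {subset d <= [:: a0; b0]} ->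
  exists a b k, [/\ [set a; b]%SET = [set a0; b0]%SET, a != b,
    act d =1 act (zig a b k), (k <= size d)%N
    & [edge a; b] -> (k <= m_ a b)%N].
Proof.
move=> ab0; elim: d => [_|x d IH sub]; first by exists a0, b0, 0%N; split.
have [|a [b [k [eab ab ad kd km]]]] := IH.
  by move=> z zd; apply: sub; rewrite inE zd orbT.
have : x \in [set a; b]%SET.
  by rewrite eab !inE; have := sub x (mem_head _ _); rewrite !inE.
rewrite !inE => /orP[/eqP ->|/eqP ->] {x sub}.
  case: k ad kd km => [|k] ad kd km.
    exists a, b, 1%N; split=> // [p|/label_gt1/ltnW //].
    by rewrite act_cons ad.
  exists b, a, k; split=> //=; first by rewrite finset.setUC.
  - by rewrite eq_sym.
  - by move=> p; rewrite act_cons ad act_cons reflK.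
  - by rewrite (leq_trans _ (leqnSn _)) // ltnW.
  - by rewrite finset.setUC => /km/ltnW.
have ba : b != a by rewrite eq_sym.
have [/andP[e /eqP ek]|he] := boolP ([edge a; b] && (k == m_ a b)).
  have m1 := label_gt1 e; case: k ek ad kd km => [ek|k ek ad kd km].
    by rewrite -ek in m1.
  exists a, b, k; split=> //=; first 1 last.
  - by rewrite (leq_trans _ (leqnSn _)) // ltnW.
  - by move=> _; rewrite -ek.
  by move=> p; rewrite act_cons ad ek braid // -ek act_cons reflK.
exists b, a, k.+1; split=> //=; first by rewrite finset.setUC.
  by move=> p; rewrite !act_cons ad.
rewrite finset.setUC => e; rewrite ltn_neqAle km // andbT.
by move: he; rewrite e.
Qed.

Lemma zig_desc a b k s : a != b -> s = (if odd k then b else a) ->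
  ([edge a; b] -> (k < m_ a b)%N) ->
  act (zig a b k.+1) =1 act (rcons (zig a b k) s) /\
  cone a b (- act (zig a b k.+1) (alpha s)).
Proof.
move=> ab es h.
have e : act (zig a b k.+1) =1 act (rcons (zig a b k) s).
  by move=> p; rewrite zigS -es cats1.
split=> //; rewrite e act_rcons refl_root actN opprK es.
exact: zig_cone.
Qed.

(** The rank two case of [root_descent]. *)
Lemma dihedral_root s t d : s != t -> {subset d <= [:: s; t]} ->
  cone s t (act d (alpha s)) \/
  cone s t (- act d (alpha s)) /\
  exists d', (size d' < size d)%N /\ act d =1 act (rcons d' s).
Proof.
move=> st sub; have [a [b [k [eab ab ad kd km]]]] := zig_normal st sub.
have ba : b != a by rewrite eq_sym.
have coneab p : cone a b p -> cone s t p.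
  have : a \in [set s; t]%SET by rewrite -eab !inE eqxx.
  have : b \in [set s; t]%SET by rewrite -eab !inE eqxx orbT.
  rewrite !inE => /orP[]/eqP eb /orP[]/eqP ea; subst a b => //.
  - by rewrite eqxx in ab.
  - exact: coneC.
  - by rewrite eqxx in ab.
have sab : s \in [set a; b]%SET by rewrite eab !inE eqxx.
rewrite ad.
have desc a' b' : [set a'; b']%SET = [set a; b]%SET -> a' != b' ->
    act d =1 act (zig a' b' k) -> s = (if odd k then a' else b') -> (0 < k)%N ->
    (cone a' b' (- act (zig a b k) (alpha s)) /\
     exists d', (size d' < size d)%N /\ act d =1 act (rcons d' s)).
  move=> e' ab' ad' es k0; case: k k0 ad' ad es km kd => [//|k] _ ad' ad es km kd.
  have es' : s = if odd k then b' else a' by rewrite es /= if_neg.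
  have km' : [edge a'; b'] -> (k < m_ a' b')%N by rewrite e'.
  have [e1 e2] := zig_desc ab' es' km'.
  rewrite -ad ad'; split=> //; exists (zig a' b' k); rewrite size_zig; split=> //.
  by move=> p; rewrite ad'.
have [es|es] := eqVneq s (if odd k then b else a).
  have [/andP[e /eqP ek]|he] := boolP ([edge a; b] && (k == m_ a b)).
    right; have [||||| h1 h2] := desc b a.
    - by rewrite finset.setUC.
    - by [].
    - by move=> p; rewrite ad ek braid.
    - by rewrite es.
    - by rewrite ek ltnW // label_gt1.
    by split=> //; apply/coneab/coneC.
  left; rewrite {2}es; apply/coneab/zig_cone => // e.
  by rewrite ltn_neqAle km // andbT; move: he; rewrite e.
have {es} es : s = if odd k then a else b.
  by move: sab es; rewrite !inE; case: odd => /orP[]/eqP->; rewrite ?eqxx.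
have [k0|k0] := posnP k; last first.
  by right; have [//|//|//|//|//|h1 h2] := desc a b; split=> //; apply: coneab.
left; rewrite k0 /=; exists 1, 0; split=> //.
by rewrite scale1r scale0r addr0.
Qed.

(** The claim on the signs of roots is proved by induction together with a weak
    form of the exchange condition: if w alpha_s is not nonnegative then w r_s is
    given by a shorter word than w.  If w ends with t different from s, write w
    as v d with d a word in s and t, without increasing the total length and with
    v as short as possible.  By induction v alpha_s and v alpha_t are nonnegative,
    as otherwise a letter could be moved from v to d, and what remains is the
    statement for d. *)
Lemma root_descent w s :
  nonneg (act w (alpha s)) \/
  nonneg (- act w (alpha s)) /\
  exists w', (size w' < size w)%N /\ act w =1 act (rcons w' s).
Proof.
have [n] := ubnP (size w); elim: n w s => // n IH w s.
case/lastP: w => [_|u t]; first by left; apply: nonneg_alpha.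
rewrite ltnS => un; have sut : size (rcons u t) = (size u).+1 by rewrite size_rcons.
have [->|ts] := eqVneq t s.
  rewrite act_rcons refl_root actN opprK.
  have [|h|[h _]] := IH u s; first by rewrite -sut.
    by right; split=> //; exists u; rewrite size_rcons.
  by left.
have st : s != t by rewrite eq_sym.
(* k bounds the length of v, on which the inner induction runs. *)
suff main k : forall v d, (size v < k)%N -> (size v <= size u)%N ->
    {subset d <= [:: s; t]} -> act (rcons u t) =1 act (v ++ d) ->
    (size v + size d <= size (rcons u t))%N ->
  nonneg (act (rcons u t) (alpha s)) \/
  nonneg (- act (rcons u t) (alpha s)) /\
  exists w', (size w' < size (rcons u t))%N /\ act (rcons u t) =1 act (rcons w' s).
  apply: (main (size u).+1 u [:: t]) => //.
  - by move=> z; rewrite !inE => ->; rewrite orbT.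
  - by move=> p; rewrite cats1.
  - by rewrite sut addn1.
elim: k => // k IHk v d; rewrite ltnS => vk vu sub e sz.
have vn : (size v < n)%N by apply: leq_ltn_trans vu _; rewrite -sut.
have shorter a v' : a \in [:: s; t] -> (size v' < size v)%N ->
    act v =1 act (rcons v' a) ->
    nonneg (act (rcons u t) (alpha s)) \/
    nonneg (- act (rcons u t) (alpha s)) /\
    exists w', (size w' < size (rcons u t))%N /\ act (rcons u t) =1 act (rcons w' s).
  move=> ain sv' ev; apply: (IHk v' (a :: d)).
  - exact: leq_trans vk.
  - exact: leq_trans (ltnW sv') vu.
  - by move=> z; rewrite inE => /orP[/eqP->//|/sub].
  - by move=> p; rewrite e !act_cat ev act_rcons.
  - by apply: leq_trans sz; rewrite /= addnS -addSn leq_add2r.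
have [hs|[_ [v' [sv' ev]]]] := IH v s vn; last first.
  by apply: shorter ev; rewrite // mem_head.
have [ht|[_ [v' [sv' ev]]]] := IH v t vn; last first.
  by apply: shorter ev; rewrite // !inE eqxx orbT.
have pos p : cone s t p -> nonneg (act v p).
  move=> [c [c' [hc hc' ->]]]; rewrite actD !actZ.
  by apply: nonnegD; apply: nonnegZ.
have [h|[h [d' [sd ed]]]] := dihedral_root st sub.
  by left; rewrite e act_cat; apply: pos.
right; split; first by rewrite e act_cat -actN; apply: pos.
exists (v ++ d'); rewrite size_cat; split.
  by apply: leq_trans sz; rewrite ltn_add2l.
by move=> p; rewrite e !act_cat rcons_cat act_cat ed.
Qed.

Lemma root_sign w s : nonneg (act w (alpha s)) \/ nonneg (- act w (alpha s)).
Proof. by have [|[]] := root_descent w s; [left|right]. Qed.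

End Roots.

(** * The cocycle of minimal coset representatives *)

Section Machine.
Local Open Scope ring_scope.
Variables (R : realType) (Gamma : labeled_graph) (Delta : {set Gamma}).
Local Notation V := {ffun Gamma -> R^o}.
Local Notation alpha := (simple_root R).
Local Notation act := (@act R Gamma).
Local Notation "[ 'edge' s ; t ]" := ([set s; t]%SET \in edges Gamma).
Local Notation m_ s t := (label [set s; t]%SET).
Local Notation aeq := (pres_eq (@artin_rels Gamma)).
Implicit Types (p q : V) (v : V -> V) (r s t a b x y : Gamma) (w d : seq Gamma).
Implicit Types (l : Gamma * bool) (u : word Gamma).

(** These maps are the inverses of the minimal length representatives of the
    right cosets of W_Delta. *)
Definition reduced v :=
  (exists w, v = act w) /\ forall x, x \in Delta -> nonneg (v (alpha x)).

(** The generator r fixes the coset encoded by v exactly when it hits, because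
    then r v = v r_x. *)
Definition hit v r : option Gamma := [pick x in Delta | v (alpha x) == alpha r].
Definition step v r : V -> V := if hit v r is Some _ then v else refl r \o v.
Definition letter_output v l : word Gamma :=
  if hit v l.1 is Some x then [:: (x, l.2)] else [::].
Fixpoint end_state v u : V -> V := if u is l :: u' then end_state (step v l.1) u' else v.
Fixpoint output v u : word Gamma :=
  if u is l :: u' then letter_output v l ++ output (step v l.1) u' else [::].

Lemma end_state_cat v u u' : end_state v (u ++ u') = end_state (end_state v u) u'.
Proof. by elim: u v => //= l u IH v. Qed.

Lemma output_cat v u u' : output v (u ++ u') = output v u ++ output (end_state v u) u'.
Proof. by elim: u v => //= l u IH v; rewrite IH catA. Qed.

Lemma hitP v r x : hit v r = Some x -> x \in Delta /\ v (alpha x) = alpha r.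
Proof. by rewrite /hit; case: pickP => // y /andP[yD /eqP e] [<-]. Qed.

Lemma hit_some v r x : reduced v -> x \in Delta -> v (alpha x) = alpha r ->
  hit v r = Some x.
Proof.
move=> [[w ->] _] xD e; rewrite /hit; case: pickP => [y /andP[_ /eqP ey]|/(_ x)].
  by congr Some; apply/(@alpha_inj R)/(act_inj (w := w)); rewrite ey.
by rewrite xD e eqxx.
Qed.

(** If r does not hit, no root v alpha_x with x in Delta is alpha_r, so
    [simple_root_flip] keeps all of them nonnegative. *)
Lemma reduced_step v r : reduced v -> reduced (step v r).
Proof.
move=> rv; rewrite /step; case e: (hit v r) => [//|].
have [[w ev] pos] := rv; split; first by exists (r :: w); rewrite ev.
move=> x xD; have [|h] := root_sign R (r :: w) x; first by rewrite ev.
have ex : v (alpha x) = alpha r.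
  by rewrite ev; apply: simple_root_flip => //; rewrite -ev; apply: pos.
by rewrite (hit_some rv xD ex) in e.
Qed.

Lemma reduced_end_state v u : reduced v -> reduced (end_state v u).
Proof. by elim: u v => //= l u IH v /(reduced_step l.1)/IH. Qed.

(** A hit leaves v in place where the linear action would give r v = v r_x; the
    letter x of the output makes up for the difference.  Hence two words with the
    same action and the same output lead to the same state. *)
Lemma end_stateE v u p : reduced v ->
  end_state v u p = act (rev (map fst u)) (v (act (map fst (output v u)) p)).
Proof.
elim: u v => //= l u IH v rv; rewrite IH; last exact: reduced_step.
rewrite rev_cons act_rcons; congr (act _ _); rewrite /letter_output /step.
case e: (hit v l.1) => [x|//].
have [_ ex] := hitP e; have [[w ev] _] := rv; rewrite ev in ex *.
by rewrite /= (refl_act _ ex) act_cons reflK.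
Qed.

Lemma hit_step v r : reduced v -> hit v r = None -> hit (refl r \o v) r = None.
Proof.
move=> [_ pos] e; case e': (hit _ r) => [x|//].
have [xD /= ex] := hitP e'; have := pos x xD r.
rewrite -[v _](reflK r) ex refl_root ffunE alphaE.
by rewrite oppr_ge0 ler10.
Qed.

Lemma run_cancel v l : reduced v ->
  end_state v [:: l; inv_letter l] = v /\ aeq (output v [:: l; inv_letter l]) [::].
Proof.
move=> rv; rewrite /= /letter_output /step /=; case e: (hit v l.1) => [x|].
  rewrite e /=; split=> //; exact: (pres_cancel _ (x, l.2)).
rewrite hit_step //=; split; last exact: pres_refl.
by apply/funext => p /=; rewrite reflK.
Qed.

Definition in_plane v s t x :=
  [forall a, (a != s) ==> (a != t) ==> (v (alpha x) a == 0)].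

Lemma in_planeP v s t x :
  reflect (forall a, a != s -> a != t -> v (alpha x) a = 0) (in_plane v s t x).
Proof.
apply: (iffP forallP) => [h a as_ at_|h a].
  by have := h a; rewrite as_ at_ => /eqP.
by apply/implyP => as_; apply/implyP => at_; rewrite h.
Qed.

Lemma in_planeC v s t x : in_plane v s t x = in_plane v t s x.
Proof. by apply/in_planeP/in_planeP => h a h1 h2; apply: h. Qed.

Lemma in_plane_root v s t x : v (alpha x) = alpha s -> in_plane v s t x.
Proof. by move=> e; apply/in_planeP => a as_ _; rewrite e alpha_neq // eq_sym. Qed.

Lemma in_plane_span v s t x : s != t -> in_plane v s t x ->
  v (alpha x) = v (alpha x) s *: alpha s + v (alpha x) t *: alpha t.
Proof.
move=> st /in_planeP h; apply/ffunP => a; rewrite !ffunE /GRing.scale /=.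
have [->|as_] := eqVneq a s; first by rewrite (negPf st) mulr1 mulr0 addr0.
have [->|at_] := eqVneq a t; first by rewrite mulr1 mulr0 add0r.
by rewrite h // !mulr0 addr0.
Qed.

Lemma act_coord w s t p a : {subset w <= [:: s; t]} -> a != s -> a != t ->
  act w p a = p a.
Proof.
move=> sub as_ at_; elim: w sub => [//|r w IH] sub; rewrite act_cons refl_neq.
  by apply: IH => z zw; apply: sub; rewrite inE zw orbT.
have := sub r (mem_head _ _); rewrite !inE => /orP[] /eqP ->; first exact: as_.
exact: at_.
Qed.

Lemma zig_sub a b k : {subset zig a b k <= [:: a; b]}.
Proof.
elim: k a b => [//|k IH] a b z; rewrite inE => /orP[/eqP->|/IH].
  exact: mem_head.
by rewrite !inE orbC.
Qed.

Definition pos_word d : word Gamma := [seq (a, false) | a <- d].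

Lemma pos_wordK d : map fst (pos_word d) = d.
Proof. by rewrite -map_comp map_id. Qed.

Lemma alternatingE a b k : Defs.alternating a b k = pos_word (zig a b k).
Proof.
elim: k a b => [//|k IH] a b; rewrite /= -IH /Defs.alternating /=; congr (_ :: _).
rewrite -[1%N]addn0 iotaDl -map_comp; apply: eq_map => i /=.
by case: odd.
Qed.

(** Both alpha_s and alpha_t are combinations of v alpha_x and v alpha_y.  Since
    the inverse image of alpha_s under v is a root, the two coefficients of
    alpha_s have the same sign; with the nonnegativity of v alpha_x and v alpha_y
    this is only possible if alpha_s is one of them, and likewise for
    alpha_t. *)
Lemma two_in_plane v s t x y : reduced v -> x \in Delta -> y \in Delta ->
  x != y -> s != t -> in_plane v s t x -> in_plane v s t y ->
  v (alpha x) = alpha s /\ v (alpha y) = alpha t \/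
  v (alpha x) = alpha t /\ v (alpha y) = alpha s.
Proof.
move=> [[w ev] pos] xD yD xy st px py.
have ex := in_plane_span st px; have ey := in_plane_span st py.
have key s' t' (c c' f f' : R) : 0 <= c' -> 0 <= f' ->
    v (alpha x) = c *: alpha s' + c' *: alpha t' ->
    v (alpha y) = f *: alpha s' + f' *: alpha t' -> c' = 0 \/ f' = 0.
  move=> hc hd e1 e2.
  (* Cramer's rule without division: the inverse of v is applied to the
     combination that eliminates alpha_t'. *)
  have e : f' *: alpha x - c' *: alpha y
      = (f' * c - c' * f) *: act (rev w) (alpha s').
    apply: (act_inj (w := w)); rewrite actD actN !actZ act_revKV -ev e1 e2.
    by apply/ffunP => a; rewrite !ffunE /GRing.scale /=; ring.
  have e_x : f' = (f' * c - c' * f) * act (rev w) (alpha s') x.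
    have /ffunP/(_ x) := e; rewrite !ffunE eqxx (negPf xy) /GRing.scale /=.
    by rewrite mulr1 mulr0 subr0.
  have e_y : - c' = (f' * c - c' * f) * act (rev w) (alpha s') y.
    have /ffunP/(_ y) := e; rewrite !ffunE eqxx eq_sym (negPf xy) /GRing.scale /=.
    by rewrite mulr1 mulr0 add0r.
  have : 0 <= act (rev w) (alpha s') x * act (rev w) (alpha s') y.
    have [h|h] := root_sign R (rev w) s'; first by rewrite mulr_ge0.
    by rewrite -mulrNN mulr_ge0 //; [have := h x|have := h y]; rewrite ffunE.
  set A := _ x; set B := _ y => AB.
  have : 0 <= f' * - c'.
    by rewrite e_x e_y mulrACA mulr_ge0 // -expr2 sqr_ge0.
  rewrite mulrN oppr_ge0 => h.
  have /eqP : f' * c' = 0 by apply/eqP; rewrite eq_le h mulr_ge0.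
  by rewrite mulf_eq0 => /orP[]/eqP; [right|left].
have unit_x s' c : 0 <= c -> v (alpha x) = c *: alpha s' -> v (alpha x) = alpha s'.
  by rewrite ev; apply: root_multiple.
have unit_y s' c : 0 <= c -> v (alpha y) = c *: alpha s' -> v (alpha y) = alpha s'.
  by rewrite ev; apply: root_multiple.
have nz z : v (alpha z) <> 0 by rewrite ev; apply/eqP/act_root_neq0.
have px0 a := pos x xD a; have py0 a := pos y yD a.
have [t0|t0] := key _ _ _ _ _ _ (px0 t) (py0 t) ex ey;
have [s0|s0] := key _ _ _ _ _ _ (px0 s) (py0 s)
  (etrans ex (addrC _ _)) (etrans ey (addrC _ _)).
- by case: (nz x); rewrite ex t0 s0 !scale0r addr0.
- left; split; [apply: unit_x (px0 s) _|apply: unit_y (py0 t) _].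
    by rewrite {1}ex t0 scale0r addr0.
  by rewrite {1}ey s0 scale0r add0r.
- right; split; [apply: unit_x (px0 t) _|apply: unit_y (py0 s) _].
    by rewrite {1}ex s0 scale0r add0r.
  by rewrite {1}ey t0 scale0r addr0.
- by case: (nz y); rewrite ey t0 s0 !scale0r addr0.
Qed.

Lemma run_fixed v s t x y k : reduced v -> x \in Delta -> y \in Delta ->
  v (alpha x) = alpha s -> v (alpha y) = alpha t ->
  end_state v (pos_word (zig s t k)) = v /\
  output v (pos_word (zig s t k)) = pos_word (zig x y k).
Proof.
move=> rv; elim: k s t x y => [//|k IH] s t x y xD yD ex ey /=.
rewrite /letter_output /step /= (hit_some rv xD ex) /=.
by have [-> ->] := IH t s y x yD xD ey ex.
Qed.

(** The form is invariant and its value on two distinct simple roots determines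
    the label. *)
Lemma edge_image w s t x y : [edge s; t] ->
  act w (alpha x) = alpha s -> act w (alpha y) = alpha t ->
  [edge x; y] /\ m_ x y = m_ s t.
Proof.
move=> e ex ey; have st := edge_neq e.
have xy : x != y.
  by apply: contraNneq st => exy; apply/eqP/(@alpha_inj R); rewrite -ex -ey exy.
have := form_act w (alpha x) (alpha y); rewrite ex ey !form_root (cartan_edge _ e).
rewrite /cartan (negPf xy); case: ifP => [exy|_] h.
  split=> //; have /(mulfI _) h' := oppr_inj h.
  apply/esym/(@cos_angle_inj R); rewrite ?label_gt1 //; apply: h'.
  by rewrite pnatr_eq0.
have : cos (pi / (m_ s t)%:R : R) == 1 by apply/eqP; lra.
by rewrite (negPf (cos_angle_neq1 _ (label_gt1 e))).
Qed.

Definition alone v s t x := forall y, y \in Delta -> in_plane v s t y -> y = x.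

Lemma in_plane_act v w s t y : {subset w <= [:: s; t]} ->
  in_plane (act w \o v) s t y = in_plane v s t y.
Proof.
move=> sub; apply/in_planeP/in_planeP => h a h1 h2; have := h a h1 h2.
  by rewrite /= (act_coord _ sub).
by move=> e; rewrite /= (act_coord _ sub).
Qed.

Lemma zig_rev_cone a b k : a != b -> ([edge a; b] -> (k < m_ a b)%N) ->
  cone a b (act (rev (zig b a k)) (alpha a)).
Proof.
move=> ab h; rewrite rev_zig; have := @zig_cone R Gamma b a k.
have := @zig_cone R Gamma a b k ab h; rewrite eq_sym finset.setUC.
by case: odd => h1 h2 //; apply/coneC/h2.
Qed.

Lemma silent_end_state v u : reduced v -> output v u = [::] ->
  end_state v u = act (rev (map fst u)) \o v.
Proof. by move=> rv e; apply/funext => p; rewrite end_stateE // e. Qed.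

(** After the hit v alpha_x = alpha_a, fewer than m alternating letters starting
    with b keep this root positive, whereas a second hit would mean that the next
    letter negates it. *)
Lemma output_after_hit v a b x k : reduced v -> a != b -> alone v a b x ->
  v (alpha x) = alpha a -> ([edge a; b] -> (k < m_ a b)%N) ->
  output v (pos_word (zig b a k)) = [::].
Proof.
move=> rv ab al ex; elim: k => [//|k IH] h.
have e0 : output v (pos_word (zig b a k)) = [::] by apply: IH => /h/ltnW.
have ef := silent_end_state rv e0; rewrite pos_wordK in ef.
rewrite zigS /pos_word map_cat output_cat -/(pos_word _) e0 /= cats0 /letter_output /=.
case e: (hit _ _) => [y|//]; have [yD ey] := hitP e.
have sub : {subset rev (zig b a k) <= [:: a; b]}.
  by move=> z; rewrite mem_rev => /zig_sub; rewrite !inE orbC.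
have yx : y = x.
  apply: al => //; rewrite -(in_plane_act _ _ sub) -ef.
  by move: ey; case: odd => ey; [|rewrite in_planeC]; apply: in_plane_root ey.
subst y; rewrite ef /= ex in ey.
have /cone_nonneg c := zig_rev_cone ab h.
case: (root_not_both c); rewrite zigS rev_cat /= act_cons ey refl_root opprK.
exact: nonneg_alpha.
Qed.

Lemma output_alone v a b x k : reduced v -> a != b -> alone v a b x ->
  ([edge a; b] -> (k <= m_ a b)%N) ->
  output v (pos_word (zig a b k)) = [::] \/
  output v (pos_word (zig a b k)) = [:: (x, false)] /\
  (x \in Delta /\ in_plane v a b x).
Proof.
elim: k v a b => [|k IH] v a b rv ab al h; first by left.
have ba : b != a by rewrite eq_sym.
rewrite /= -/(pos_word _) /letter_output /=; case e: (hit v a) => [y|] /=; last first.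
  have sub : {subset [:: a] <= [:: b; a]} by move=> z; rewrite !inE => ->; rewrite orbT.
  have es : step v a = act [:: a] \o v by rewrite /step e.
  have := IH (step v a) b a (reduced_step a rv) ba.
  have plane y : in_plane (step v a) b a y = in_plane v a b y.
    by rewrite es in_plane_act // in_planeC.
  rewrite plane finset.setUC; apply=> [y yD|/h/ltnW //].
  by rewrite plane; apply: al.
have [yD ey] := hitP e; have py := in_plane_root b ey.
have yx := al y yD py; subst y.
rewrite /step e (output_after_hit rv ab al ey) //; by right.
Qed.

(** The alternating word of length m is the longest element of the dihedral
    group. *)
Lemma longest_neg a b : [edge a; b] ->
  cone a b (- act (rev (zig a b (m_ a b))) (alpha a)).
Proof.
move=> e; have ab := edge_neq e; have := label_gt1 e.
case em: (m_ a b) => [//|m] _.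
rewrite /= rev_cons act_rcons refl_root actN opprK.
by apply: zig_rev_cone => // _; rewrite em.
Qed.

(** With an empty output the state would be moved by the longest element, which
    makes the root v alpha_x of the plane nonpositive. *)
Lemma output_longest v a b x : [edge a; b] -> reduced v -> x \in Delta ->
  in_plane v a b x -> output v (pos_word (zig a b (m_ a b))) <> [::].
Proof.
move=> e rv xD px e0; have ab := edge_neq e.
have [_ /(_ x xD)] := reduced_end_state (pos_word (zig a b (m_ a b))) rv.
rewrite silent_end_state // pos_wordK /=; have [[w ev] pos] := rv.
rewrite ev -act_cat => /root_not_both; apply.
rewrite act_cat -ev (in_plane_span ab px) actD !actZ opprD -!scalerN.
apply: nonnegD; apply: nonnegZ; try exact: pos.
  exact/cone_nonneg/longest_neg.
have e' : [edge b; a] by rewrite finset.setUC.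
have := longest_neg e'; rewrite finset.setUC -(braid_rev e).
exact: cone_nonneg.
Qed.

Lemma run_braid v s t : [edge s; t] -> reduced v ->
  aeq (output v (Defs.alternating s t (m_ s t))) (output v (Defs.alternating t s (m_ s t)))
  /\ end_state v (Defs.alternating s t (m_ s t)) = end_state v (Defs.alternating t s (m_ s t)).
Proof.
move=> e rv; have st := edge_neq e; have ts : t != s by rewrite eq_sym.
have e' : [edge t; s] by rewrite finset.setUC.
have mC : m_ t s = m_ s t by rewrite finset.setUC.
rewrite !alternatingE.
have one x : alone v s t x ->
    aeq (output v (pos_word (zig s t (m_ s t)))) (output v (pos_word (zig t s (m_ s t))))
  /\ end_state v (pos_word (zig s t (m_ s t))) = end_state v (pos_word (zig t s (m_ s t))).
  move=> al; have al' : alone v t s x by move=> y yD; rewrite in_planeC; apply: al.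
  suff ee : output v (pos_word (zig s t (m_ s t))) = output v (pos_word (zig t s (m_ s t))).
    split; first by rewrite ee; apply: pres_refl.
    by apply/funext => p; rewrite !end_stateE // ee !pos_wordK braid_rev.
  have n1 y := @output_longest v s t y e rv.
  have n2 y := @output_longest v t s y e' rv; rewrite mC in n2.
  have [e1|[e1 [xD px]]] := output_alone rv st al (fun _ => leqnn _);
  have := output_alone (k := m_ t s) rv ts al' (fun _ => leqnn _); rewrite mC.
  - case=> [->//|[_ [xD px]]]; case: (n1 x xD) => //.
    by rewrite in_planeC.
  - case=> [e2|[-> _]]; last by [].
    by case: (n2 x xD) => //; rewrite in_planeC.
have [x /andP[xD px]|none] := pickP [pred x in Delta | in_plane v s t x]; last first.
  by apply: (one s) => y yD py; have := none y; rewrite /= yD py.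
have [y /and3P[yD py yx]|none] :=
    pickP [pred y in Delta | in_plane v s t y && (y != x)]; last first.
  apply: (one x) => y yD py; apply/eqP; have := none y.
  by rewrite /= yD py; case: eqP.
have both a b : a \in Delta -> b \in Delta ->
    v (alpha a) = alpha s -> v (alpha b) = alpha t ->
    aeq (output v (pos_word (zig s t (m_ s t)))) (output v (pos_word (zig t s (m_ s t))))
  /\ end_state v (pos_word (zig s t (m_ s t))) = end_state v (pos_word (zig t s (m_ s t))).
  move=> aD bD ea eb; have [[w ev] _] := rv.
  have [-> ->] := run_fixed (m_ s t) rv aD bD ea eb.
  have [-> ->] := run_fixed (m_ s t) rv bD aD eb ea.
  split=> //; rewrite ev in ea eb; have [eab <-] := edge_image e ea eb.
  by apply: pres_rel; exists a, b; rewrite /= !alternatingE.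
have xy : x != y by rewrite eq_sym.
by have [[ex ey]|[ex ey]] := two_in_plane rv xD yD xy st px py;
  [apply: (both x y)|apply: (both y x)].
Qed.

Lemma run_pres_eq u u' : aeq u u' -> forall v, reduced v ->
  end_state v u = end_state v u' /\ aeq (output v u) (output v u').
Proof.
elim=> {u u'} [u|u u' _ IH|u u' u'' _ IH1 _ IH2|u1 u1' u2 u2' _ IH1 _ IH2|l|u u' [s [t [e [-> ->]]]]] v rv.
- by split=> //; apply: pres_refl.
- by have [-> h] := IH v rv; split=> //; apply: pres_sym.
- have [-> h1] := IH1 v rv; have [-> h2] := IH2 v rv.
  by split=> //; apply: pres_trans h1 h2.
- rewrite !end_state_cat !output_cat; have [<- h1] := IH1 v rv.
  have [<- h2] := IH2 _ (reduced_end_state u1 rv).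
  by split=> //; apply: pres_cat.
- exact: run_cancel.
- have [h ->] := run_braid e rv.
  by split.
Qed.

End Machine.

(** * Parabolic subgroups *)

Section Parabolics.
Local Open Scope group_scope.
Local Open Scope quotient_scope.
Variable Gamma : labeled_graph.
Local Notation A := (artin Gamma).
Local Notation aeq := (pres_eq (@artin_rels Gamma)).
Implicit Types (X Omega Delta : {set Gamma}) (g h k : A) (x y : Gamma).
Implicit Types (u w : word Gamma).

Definition artin_word u : A := \pi_(presented (@artin_rels Gamma)) u.

Lemma artin_wordP u w : artin_word u = artin_word w <-> aeq u w.
Proof. exact: pres_piP. Qed.

Lemma artin_word_cat u w : artin_word (u ++ w) = artin_word u * artin_word w.
Proof. exact/esym/pres_mul_pi. Qed.

Lemma artin_word_inv u : artin_word (inv_word u) = (artin_word u)^-1.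
Proof. exact/esym/pres_inv_pi. Qed.

Lemma artin_word_gen x : artin_word [:: (x, false)] = artin_gen x.
Proof. by []. Qed.

Lemma artin_word_surj g : exists u, artin_word u = g.
Proof. by exists (repr g); rewrite /artin_word reprK. Qed.

Definition word_over X u := all (fun l => l.1 \in X) u.

Lemma subgroup_std_parabolic X : subgroup (std_parabolic X).
Proof.
split=> [H hH|x y hx hy H hH|x hx H hH].
- by have [[]] := hH.
- by have [[_ hM _] _] := hH; apply: hM; [apply: hx|apply: hy].
- by have [[_ _ hV] _] := hH; apply: hV; apply: hx.
Qed.

Lemma gen_std_parabolic X x : x \in X -> std_parabolic X (artin_gen x).
Proof. by move=> xX H [_]; apply; exists x. Qed.

Lemma word_over_parabolic X u : word_over X u -> std_parabolic X (artin_word u).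
Proof.
have [h1 hM hV] := subgroup_std_parabolic X.
elim: u => [//|[x b] u IH] /andP[/= xX /IH hu].
rewrite -cat1s artin_word_cat; apply: hM hu.
case: b; last exact: gen_std_parabolic.
rewrite -[[:: _]]/(inv_word [:: (x, false)]) artin_word_inv.
by apply: hV; apply: gen_std_parabolic.
Qed.

Lemma word_over_inv X u : word_over X u -> word_over X (inv_word u).
Proof. by rewrite /word_over /inv_word all_rev all_map. Qed.

Lemma parabolic_word X g : std_parabolic X g ->
  exists u, word_over X u /\ artin_word u = g.
Proof.
move=> /(_ [set g | exists u, word_over X u /\ artin_word u = g]%classic).
apply; split; first split.
- by exists [::].
- move=> _ _ [u [hu <-]] [w [hw <-]]; exists (u ++ w).
  by rewrite artin_word_cat /word_over all_cat; split=> //; apply/andP.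
- move=> _ [u [hu <-]]; exists (inv_word u).
  by rewrite artin_word_inv word_over_inv.
- move=> _ [x /= xX <-]; exists [:: (x, false)].
  by rewrite /word_over /= xX.
Qed.

Let R : realType := Rdefinitions.R.
Local Notation V := {ffun Gamma -> R^o}.
Local Notation alpha := (simple_root R).

Lemma reduced_id Delta : reduced Delta (@id V).
Proof. by split=> [|x _]; [exists [::]|apply: nonneg_alpha]. Qed.

Lemma run_over Delta u : word_over Delta u ->
  end_state Delta (@id V) u = id /\ output Delta (@id V) u = u.
Proof.
elim: u => [//|[x b] u IH] /andP[/= xD /IH [e1 e2]].
rewrite /letter_output /step (hit_some (reduced_id Delta) xD) //=.
by rewrite e1 e2.
Qed.

Lemma output_over Delta (v : V -> V) u : word_over Delta (output Delta v u).
Proof.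
elim: u v => //= l u IH v; rewrite /word_over all_cat -/(word_over _ _) -/(word_over _ _).
rewrite IH andbT /letter_output; case e: (hit _ _ _) => [x|//].
by rewrite /= (hitP e).1.
Qed.

(** The element e is the output of k read from the trivial coset, and f sends y to
    the generator that y hits at the coset reached by k.  The generator y hits
    because k y k^-1 fixes the trivial coset, and reading is injective on cosets;
    a letter that does not hit moves the coset. *)
Lemma conj_gen_into_parabolic Omega Delta k :
  (forall y, y \in Omega -> std_parabolic Delta (k * artin_gen y * k^-1)) ->
  exists (e : A) (f : Gamma -> Gamma), [/\ std_parabolic Delta e,
    {in Omega &, injective f},
    (forall y, y \in Omega -> f y \in Delta) &
    forall y, y \in Omega -> k * artin_gen y * k^-1 = e * artin_gen (f y) * e^-1].
Proof.
move=> hk; have [u eu] := artin_word_surj k.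
pose v := end_state Delta (@id V) u.
have rid := reduced_id Delta; have rv : reduced Delta v := reduced_end_state u rid.
pose e := output Delta (@id V) u.
have [back back_e] : end_state Delta v (inv_word u) = id /\
    aeq (e ++ output Delta v (inv_word u)) [::].
  have [] := run_pres_eq (pres_mulgV (@artin_rels Gamma) u) rid.
  by rewrite end_state_cat output_cat.
have hits y : y \in Omega -> exists x, hit Delta v y = Some x /\
    k * artin_gen y * k^-1 = artin_word e * artin_gen x * (artin_word e)^-1.
  move=> yO; have [w [wD ew]] := parabolic_word (hk y yO).
  have conj_eq : aeq (u ++ (y, false) :: inv_word u) w.
    apply/artin_wordP; rewrite ew -cat1s !artin_word_cat artin_word_inv eu.
    by rewrite mulgA artin_word_gen.
  have [] := run_pres_eq conj_eq rid; have [-> ->] := run_over wD.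
  rewrite end_state_cat output_cat /= -/v -/e /letter_output /step /=.
  case ey: (hit Delta v y) => [x|] ef ee; last first.
    (* Both v and r_y v would be sent to the trivial coset by the inverse of k, so
       they would coincide, whereas r_y is not the identity. *)
    have [z ez] : exists z, act z = v by have [[z ->] _] := rv; exists z.
    have rv' : reduced Delta (refl y \o v).
      by have := reduced_step y rv; rewrite /step ey.
    have : refl y \o v = v.
      have h (v' : V -> V) : reduced Delta v' -> end_state Delta v' (inv_word u) = id ->
          v' = end_state Delta id u.
        move=> r1 r2; have [e1 _] := run_pres_eq (pres_mulVg (@artin_rels Gamma) u) r1.
        by rewrite -[LHS]e1 end_state_cat r2.
      exact: h rv' ef.
    move=> /(congr1 (fun f => f (act (rev z) (alpha y)))) /=.
    rewrite -ez act_revKV refl_root => h.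
    have := @root_not_both R Gamma [::] y (nonneg_alpha R y).
    by rewrite act_nil h; case; apply: nonneg_alpha.
  exists x; split=> //; have /artin_wordP := ee; rewrite ew => <-.
  rewrite !artin_word_cat artin_word_gen mulgA; congr (_ * _).
  rewrite -[LHS](mulKg (artin_word e)) -(artin_word_cat e).
  by rewrite (proj2 (artin_wordP _ _) back_e) mulg1.
exists (artin_word e), (fun y => odflt y (hit Delta v y)); split.
- by apply: word_over_parabolic; apply: output_over.
- move=> y y' yO y'O; have [x [ex _]] := hits y yO; have [x' [ex' _]] := hits y' y'O.
  rewrite ex ex' /= => exx; apply: (@alpha_inj R).
  by rewrite -(hitP ex).2 -(hitP ex').2 exx.
- by move=> y /hits[x [ex _]]; rewrite ex /= (hitP ex).1.
- by move=> y /hits[x [ex ey]]; rewrite ex.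
Qed.

Lemma subgroup_conj_preim k (H : set A) : subgroup H ->
  subgroup [set x | H (k * x * k^-1)]%classic.
Proof.
move=> [h1 hM hV]; split=> [|x y /= hx hy|x /= hx].
- by rewrite /= mulg1 mulgV.
- by have := hM _ _ hx hy; rewrite !mulgA mulgVK.
- by have := hV _ hx; rewrite !invgM invgK mulgA.
Qed.

Lemma conjugateP k (H : set A) g : conjugate k H g <-> H (k^-1 * g * k).
Proof.
split=> [[x hx <-]|h]; first by rewrite !mulgA mulVg mul1g mulgVK.
by exists (k^-1 * g * k) => //; rewrite !mulgA mulgV mul1g mulgK.
Qed.

Lemma parabolic_into_standard Omega Delta k :
  (conjugate k (std_parabolic Omega) `<=` std_parabolic Delta)%classic ->
  #|Omega| <= #|Delta| /\
  (#|Omega| = #|Delta| -> (std_parabolic Delta `<=` conjugate k (std_parabolic Omega))%classic).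
Proof.
move=> sub; have [|e [f [eD finj fD ef]]] := @conj_gen_into_parabolic Omega Delta k.
  by move=> y yO; apply: sub; exists (artin_gen y) => //; apply: gen_std_parabolic.
have fsub : f @: Omega \subset Delta.
  by apply/fintype.subsetP => _ /imsetP[y yO ->]; apply: fD.
have cf : #|f @: Omega| = #|Omega| by apply: card_in_imset.
split=> [|card]; first by rewrite -cf subset_leq_card.
have fimg : f @: Omega = Delta by apply/eqP; rewrite eqEcard fsub cf card leqnn.
have [_ hM hV] := subgroup_std_parabolic Delta.
move=> g gD; apply/conjugateP.
have {gD} : std_parabolic Delta (e^-1 * g * e).
  by apply: (hM _ _ _ eD); apply: (hM _ _ _ gD); apply: hV.
set H := [set x | std_parabolic Omega (k^-1 * (e * x * e^-1) * k)]%classic.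
suff sH : (std_parabolic Delta `<=` H)%classic.
  by move=> /sH; rewrite /H /= !mulgA !mulgK.
have rw (x : A) : k^-1 * (e * x * e^-1) * k = (k^-1 * e) * x * (k^-1 * e)^-1.
  by rewrite invgM invgK !mulgA.
apply: smallest_sub.
  have := subgroup_conj_preim (k^-1 * e) (subgroup_std_parabolic Omega).
  by congr subgroup; apply/seteqP; split=> x; rewrite /H /= rw.
move=> _ [x /= xD <-]; rewrite -fimg in xD; have /imsetP[y yO ->] := xD.
rewrite /H /= -ef // !mulgA mulVg mul1g mulgVK.
exact: gen_std_parabolic.
Qed.

End Parabolics.

Local Open Scope classical_set_scope.

Theorem proposition1p5 (Gamma : labeled_graph) (Omega Delta : {set Gamma})
    (g h : artin Gamma) :
  conjugate g (std_parabolic Omega) `<=` conjugate h (std_parabolic Delta) ->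
  #|Omega| <= #|Delta| /\
  (#|Omega| = #|Delta| ->
   conjugate g (std_parabolic Omega) = conjugate h (std_parabolic Delta)).
Proof.
move=> sub.
have [|le eq] := @parabolic_into_standard Gamma Omega Delta (h^-1 * g)%g.
  move=> _ [x xO <-].
  have /conjugateP := sub (g * x * g^-1)%g (ex_intro2 _ _ x xO erefl).
  by rewrite invgM invgK !mulgA.
split=> // card; apply/seteqP; split=> // _ [x xD <-].
have /conjugateP hx := eq card x xD; apply/conjugateP; move: hx.
by rewrite invgM invgK !mulgA.
Qed.
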